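(* Let $m,n\geq k\geq 2$ be integers, and let $A\in\mathbb{R}^{m\times n}$ be such that $A<0$ (all entries negative). For every $r\in[2,k]$ and every contiguous $r\times r$ submatrix $A_r$ of $A$, fix an arbitrary choice of a nonzero vector $\alpha=(\alpha_1,-\alpha_2,\ldots,(-1)^{r-1}\alpha_r)^T\in\mathbb{R}^r$ with either all $\alpha_i\geq 0$ or all $\alpha_i\leq 0$ ($\alpha$ may depend on $A_r$), and define $$x^{A_r}:=\operatorname{adj}(A_r)\,\alpha .$$ The following statements are equivalent: (1) The matrix $A$ is totally negative of order $k$. (2) Every square submatrix of $A$ of size $r\in[2,k]$ has the sign non-reversal property on $\mathbb{R}^r_{+,-}$. (3) Every contiguous square submatrix of $A$ of size $r\in[2,k]$ has the sign non-reversal property on $\mathbb{R}^r_{\mathrm{alt}}$. (4) Every contiguous square submatrix $A_r$ of $A$ of size $r\in[2,k]$ has the sign non-reversal property for $x^{A_r}$ (i.e. on the set $\{x^{A_r}\}$).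
   Context: A real matrix is totally negative of order $k$ if all its minors of order at most $k$ are negative. A contiguous submatrix is a submatrix whose rows and columns are indexed by sets of consecutive integers. $\operatorname{adj}$ denotes the adjugate matrix, and $[a,b]$ the set of integers from $a$ to $b$. $\mathbb{R}^r_{+,-}$ is the set of vectors in $\mathbb{R}^r$ with at least one positive and at least one negative coordinate. $\mathbb{R}^r_{\mathrm{alt}}$ is the set of vectors in $\mathbb{R}^r$ whose coordinates are all nonzero and have alternating signs. A matrix $B\in\mathbb{R}^{r\times r}$ has the sign non-reversal property on a set $T\subseteq\mathbb{R}^r$ if for every $0\neq x\in T$ there exists $i\in[1,r]$ such that $x_i(Bx)_i>0$. *)

(* Defs.v *)
From HB Require Import structures.
From mathcomp Require Import all_boot all_order all_algebra.
From mathcomp Require Import boolp classical_sets reals.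

Set Implicit Arguments.
Unset Strict Implicit.
Unset Printing Implicit Defensive.

Import Order.TTheory GRing.Theory Num.Theory.
Local Open Scope ring_scope.

(* An r x r submatrix of A : 'M_(m, n) is [mxsub f g A], where f and g list the
   selected row and column indices in increasing order. *)
Definition increasing_sel (r m : nat) (f : {ffun 'I_r -> 'I_m}) : Prop :=
  forall i j : 'I_r, (i < j)%N -> (f i < f j)%N.

Definition contiguous_sel (r m : nat) (f : {ffun 'I_r -> 'I_m}) : Prop :=
  exists a : nat, forall i : 'I_r, nat_of_ord (f i) = (a + i)%N.

(* Minors have order at least 1: the empty determinant is 1. *)
Definition totally_negative (R : realType) (m n k : nat)
    (A : 'M[R]_(m, n)) : Prop :=
  forall (r : nat) (f : {ffun 'I_r -> 'I_m}) (g : {ffun 'I_r -> 'I_n}),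
    (1 <= r <= k)%N -> increasing_sel f -> increasing_sel g ->
    \det (mxsub f g A) < 0.

Definition mixed_sign (R : realType) (r : nat) : set 'cV[R]_r :=
  fun x => (exists i, 0 < x i 0) /\ (exists i, x i 0 < 0).

Definition alternating (R : realType) (r : nat) : set 'cV[R]_r :=
  fun x => (forall i, x i 0 != 0) /\
    (forall i j : 'I_r, nat_of_ord j = i.+1 -> x i 0 * x j 0 < 0).

Definition sign_non_reversal (R : realType) (r : nat) (B : 'M[R]_r)
    (T : set 'cV[R]_r) : Prop :=
  forall x : 'cV[R]_r, T x -> x != 0 -> exists i, 0 < x i 0 * (B *m x) i 0.

(* With indices starting at 0, the coordinate of index i carries (-1) ^ i. *)
Definition admissible (R : realType) (r : nat) (alpha : 'cV[R]_r) : Prop :=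
  alpha != 0 /\
  exists a : 'cV[R]_r,
    ((forall i, 0 <= a i 0) \/ (forall i, a i 0 <= 0)) /\
    alpha = \col_i ((-1) ^+ i * a i 0).

(* Main.v *)
Require Import Defs.
From HB Require Import structures.
From mathcomp Require Import all_boot all_order all_algebra.
From mathcomp Require Import boolp classical_sets reals.
From mathcomp Require Import ring lra zify.

Set Implicit Arguments.
Unset Strict Implicit.
Unset Printing Implicit Defensive.

Import Order.TTheory GRing.Theory Num.Theory.
Local Open Scope classical_set_scope.
Local Open Scope ring_scope.

(** The implication from total negativity to sign non-reversal on mixed-sign
    vectors only involves the principal minors of each square submatrix [B], all
    negative, and the negativity of its entries.  The determinant of [B + D], for
    a diagonal [D >= 0], is a combination of the principal minors of [B] with
    nonnegative coefficients, apart from the product of all the diagonal entries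
    of [D]; when some diagonal entry of [D] vanishes, that product drops out and
    the determinant is negative ([det_add_diag_neg]).  If [B] reversed the signs
    of a mixed-sign [x], one could deform [x] into [x + t |x|], which keeps the
    signs of [x] for [t < 1]; since [B |x| < 0], at some [t < 1] a coordinate of
    [B (x + t |x|)] vanishes for the first time at an index where [x] is negative,
    the signs being still reversed.  Then [x + t |x|] is in the kernel of some
    [B + D] as above, which is absurd ([N_matrix_mixed_sign]).

    Conversely, total negativity is proved by induction on the order [r] of the
    minors.  Once the minors of order [r - 1] are negative, [adj B] has a
    checkerboard sign pattern on each contiguous [r x r] submatrix [B], so
    [x = adj B alpha] is alternating, with signs opposite to those of [alpha]
    ([adj_admissible]).  As [B x = det B alpha], any index [i] with
    [x_i (B x)_i > 0] forces [det B < 0] ([det_neg_of_test]); and such an index is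
    provided both by the test on alternating vectors and by the test on the single
    vector [x].  It remains to pass from contiguous minors of order [r] to all
    minors of order [r].  This is an analogue of Fekete's lemma ([fekete]): for a
    matrix with one more column than rows, the maximal minor omitting an interior
    column is controlled by those omitting an extreme column
    ([neg_minors_interpolate]), so that one can induct on the spread of the column
    indices, and then on that of the row indices. *)

(** * Increasing index selections *)

Lemma ltn_lift n (p : 'I_n.+1) (i j : 'I_n) :
  (lift p i < lift p j)%N = (i < j)%N.
Proof. by rewrite /= !ltnNge leq_bump2. Qed.

Lemma increasing_comp_lift r n (h : {ffun 'I_r.+1 -> 'I_n}) p :
  increasing_sel h -> increasing_sel [ffun i => h (lift p i)].
Proof. by move=> hh i j ij; rewrite !ffunE hh// ltn_lift. Qed.

Lemma increasing_lift_comp r n (f : {ffun 'I_r -> 'I_n}) (p : 'I_n.+1) :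
  increasing_sel f -> increasing_sel [ffun i => lift p (f i)].
Proof. by move=> hf i j ij; rewrite !ffunE ltn_lift hf. Qed.

Lemma increasing_lift n (p : 'I_n.+1) : increasing_sel [ffun i => lift p i].
Proof. by move=> i j ij; rewrite !ffunE ltn_lift. Qed.

Lemma contiguous_increasing r n (f : {ffun 'I_r -> 'I_n}) :
  contiguous_sel f -> increasing_sel f.
Proof. by move=> [a fa] i j ij; rewrite !fa ltn_add2l. Qed.

Lemma increasing_ge r n (f : {ffun 'I_r -> 'I_n}) (i j : 'I_r) :
  increasing_sel f -> (i <= j)%N -> (f i <= f j)%N.
Proof.
move=> hf; rewrite leq_eqVlt => /orP[/eqP/val_inj-> //|/hf/ltnW//].
Qed.

(** * Matrices with negative principal minors *)

Section NMatrix.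
Variable R : realFieldType.

Definition principal_minors_neg r (B : 'M[R]_r) : Prop :=
  forall s (f : {ffun 'I_s -> 'I_r}),
    (0 < s)%N -> increasing_sel f -> \det (mxsub f f B) < 0.

Lemma principal_minors_neg_del r (B : 'M[R]_r.+1) i :
  principal_minors_neg B -> principal_minors_neg (row' i (col' i B)).
Proof.
move=> hB s f s0 hf.
rewrite (_ : mxsub _ _ _ = mxsub [ffun k => lift i (f k)]
  [ffun k => lift i (f k)] B); last by apply/matrixP=> a b; rewrite !mxE !ffunE.
exact/hB/increasing_lift_comp.
Qed.

(** The determinant is affine in each diagonal entry, its slope being the
    complementary principal minor.  Hence the positive entries of [d] can be
    removed one after the other; as [d] vanishes at [i0], the slopes are always
    determinants of the same kind, never the empty determinant [1]. *)
Lemma det_add_diag_neg r (B : 'M[R]_r) (d : 'rV[R]_r) i0 :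
  principal_minors_neg B -> (forall i, 0 <= d 0 i) -> d 0 i0 = 0 ->
  \det (B + diag_mx d) < 0.
Proof.
elim: r => [|r IHr] in B d i0 *; first by case: i0.
move: {2}(#|_|) (leqnn #|[set i | d 0 i != 0]%SET|) => c.
elim: c => [|c IHc] in d *.
  rewrite leqn0 cards_eq0 => /eqP d0 hB _ _.
  have -> : d = 0.
    apply/rowP=> i; rewrite mxE; apply/eqP/negbNE.
    by have : i \notin [set i | d 0 i != 0]%SET; [rewrite d0 inE|rewrite inE].
  rewrite linear0 addr0.
  have := hB _ [ffun i => i] isT; rewrite (_ : mxsub _ _ _ = B).
    by apply => i j; rewrite !ffunE.
  by apply/matrixP=> i j; rewrite !mxE !ffunE.
move=> dc hB d_ge0 di0.
have [dz|[j /eqP dj]] : (forall j, d 0 j = 0) \/ exists j, d 0 j <> 0.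
- case: (pickP (fun j => d 0 j != 0)) => [j /eqP dj|dz]; first by right; exists j.
  by left=> j; apply/eqP/negbNE; rewrite dz.
- apply: (IHc _ _ hB d_ge0 di0); rewrite eq_card0// => i.
  by rewrite inE dz eqxx.
have ji0 : j != i0 by apply: contraNneq dj => ->; rewrite di0.
(* Induct on the number of nonzero entries: clear the entry of index [j]. *)
pose d' := \row_i (if i == j then 0 else d 0 i).
have d'_neg : \det (B + diag_mx d') < 0.
  apply: IHc => //; [|by move=> i; rewrite mxE; case: ifP|].
    rewrite -ltnS; apply: leq_trans dc; apply: proper_card; apply/properP; split.
      by apply/fintype.subsetP=> i; rewrite !inE mxE; case: (i == j); rewrite ?eqxx.
    by exists j; rewrite !inE // mxE !eqxx.
  by rewrite mxE eq_sym (negPf ji0).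
pose dj' := col' j d.
have minor_neg : \det (row' j (col' j (B + diag_mx d))) < 0.
  rewrite (_ : row' _ _ = row' j (col' j B) + diag_mx dj'); last first.
    by apply/matrixP=> a b; rewrite !mxE (inj_eq (@lift_inj _ _)).
  case: (unliftP j i0) => [i1 e|e]; last by rewrite e eqxx in ji0.
  apply: (IHr _ _ i1) => [|i|]; first exact: principal_minors_neg_del.
  - by rewrite mxE.
  - by rewrite mxE -e.
suff -> : \det (B + diag_mx d) = \det (B + diag_mx d')
    + d 0 j * \det (row' j (col' j (B + diag_mx d))).
  have := d_ge0 j; nra.
rewrite !(expand_det_row _ j) (bigD1 j)//= [in RHS](bigD1 j)//=.
have cof i : cofactor (B + diag_mx d) j i = cofactor (B + diag_mx d') j i.
  congr (_ * \det _); apply/matrixP=> a b; rewrite !mxE.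
  by have := neq_lift j a; rewrite eq_sym => /negPf ->.
rewrite [X in _ + X = _](eq_bigr (fun i =>
  (B + diag_mx d') j i * cofactor (B + diag_mx d') j i)); last first.
  by move=> i ij; rewrite cof !mxE eq_sym (negPf ij).
have -> : \det (row' j (col' j (B + diag_mx d))) = cofactor (B + diag_mx d') j j.
  by rewrite -cof /cofactor -signr_odd oddD addbb mul1r.
rewrite cof !mxE !eqxx /=; ring.
Qed.

(** The zero coordinates of [x] are removed by deleting the corresponding rows and
    columns.  When none is left, let [t] grow from [0] until a coordinate of
    [B (x + t |x|)] vanishes where [x] is negative.  This happens before
    [t = 1], because [x + |x|] is nonnegative and nonzero, hence mapped by [B] to
    a negative vector. *)
Lemma N_matrix_mixed_sign r (B : 'M[R]_r) (x : 'cV[R]_r) :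
  (forall i j, B i j < 0) -> principal_minors_neg B ->
  (exists i, 0 < x i 0) -> (exists i, x i 0 < 0) ->
  exists i, 0 < x i 0 * (B *m x) i 0.
Proof.
elim: r => [|r IHr] in B x *; first by move=> _ _ [[]].
move=> B0 hB [ip xp] [im xm].
case: (pickP (fun i => 0 < x i 0 * (B *m x) i 0)) => [i|noti]; first by exists i.
have rev i : x i 0 * (B *m x) i 0 <= 0 by rewrite leNgt noti.
case: (pickP (fun i => x i 0 == 0)) => [i /eqP xi0|xneq0].
  have del (j : 'I_r.+1) : x j 0 != 0 -> exists j', j = lift i j'.
    by case: (unliftP i j) => [j' ->|->]; [exists j'|rewrite xi0 eqxx].
  have [jp ep] := del ip (lt0r_neq0 xp); have [jm em] := del im (ltr0_neq0 xm).
  have [j Hj] : exists j, 0 < row' i x j 0 * (row' i (col' i B) *m row' i x) j 0.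
    apply: IHr => [a b|||]; first by rewrite !mxE.
    - exact: principal_minors_neg_del.
    - by exists jp; rewrite mxE -ep.
    - by exists jm; rewrite mxE -em.
  exists (lift i j); move: Hj; rewrite !mxE.
  rewrite (bigD1_ord i)//= xi0 mulr0 add0r.
  by under eq_bigr do rewrite !mxE.
pose y := B *m x; pose v := B *m (\col_i `|x i 0|).
have v_lt0 i : v i 0 < 0.
  rewrite mxE (bigD1 ip)//= -[ltRHS]addr0 ltr_leD//.
    by rewrite mxE nmulr_rlt0// normr_gt0 gt_eqF.
  by apply: sumr_le0 => j _; rewrite mxE mulr_le0_ge0// ltW.
have yv_lt0 i : y i 0 + v i 0 < 0.
  rewrite !mxE -big_split/= (bigD1 ip)//= -[ltRHS]addr0 ltr_leD//.
    by rewrite mxE -mulrDr nmulr_rlt0// gtr0_norm// addr_gt0.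
  apply: sumr_le0 => j _; rewrite mxE -mulrDr mulr_le0_ge0 ?[B _ _ <= _]ltW//.
  by rewrite -lerBlDl sub0r -normrN ler_norm.
(* [t i] is the time at which the coordinate [i] of [B (x + t |x|)] vanishes. *)
pose t i := y i 0 / - v i 0.
have tE i : y i 0 + t i * v i 0 = 0.
  by rewrite /t; field; rewrite lt_eqF.
case: (@arg_minP _ _ _ im (fun i => x i 0 < 0) t xm) => i xi_lt0 i_min.
have y_ge0 j : x j 0 < 0 -> 0 <= y j 0.
  by move=> xj; have := rev j; rewrite nmulr_rle0.
have t_ge0 : 0 <= t i.
  by rewrite divr_ge0 ?y_ge0// oppr_ge0 ltW.
have t_lt1 : t i < 1.
  by rewrite ltr_pdivrMr ?oppr_gt0// mul1r -subr_lt0 opprK.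
pose w := x + t i *: \col_i `|x i 0|.
have wE j : w j 0 = x j 0 + t i * `|x j 0| by rewrite !mxE.
have BwE j : (B *m w) j 0 = y j 0 + t i * v j 0.
  by rewrite /w mulmxDr -scalemxAr !mxE.
have w_rev j : (0 < w j 0) && ((B *m w) j 0 <= 0)
    || (w j 0 < 0) && (0 <= (B *m w) j 0).
  have vj := v_lt0 j; have := xneq0 j; rewrite wE BwE.
  case: (ltgtP (x j 0) 0) => // xj _.
    apply/orP; right; rewrite ltr0_norm//; apply/andP; split; first by nra.
    have := i_min j xj; have := tE j; nra.
  apply/orP; left; rewrite gtr0_norm//; apply/andP; split; first by nra.
  have yj : y j 0 <= 0 by have := rev j; rewrite pmulr_rle0.
  nra.
have w_neq0 j : w j 0 != 0.
  by case/orP: (w_rev j) => [/andP[wj _]|/andP[wj _]]; [rewrite gt_eqF|rewrite lt_eqF].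
(* The diagonal for which [w] is in the kernel of [B + diag_mx d]; it vanishes at
   [i] and is nonnegative because [B] reverses the signs of [w]. *)
pose d : 'rV[R]_r.+1 := \row_j (- (B *m w) j 0 / w j 0).
have : \det (B + diag_mx d) < 0.
  apply: (@det_add_diag_neg _ _ _ i) => // [j|].
    rewrite mxE; case/orP: (w_rev j) => [/andP[w1 w2]|/andP[w1 w2]].
      by rewrite divr_ge0 ?oppr_ge0// ltW.
    by rewrite mulr_le0// ?oppr_le0// invr_le0 ltW.
  by rewrite mxE BwE tE oppr0 mul0r.
move/ltr0_neq0; rewrite -unitfE => /mulKmx K.
have : (B + diag_mx d) *m w = 0.
  apply/colP=> j; rewrite mulmxDl mul_diag_mx [LHS]mxE [X in _ + X]mxE [X in X * _]mxE.
  by rewrite [RHS]mxE divfK// subrr.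
move/(congr1 (mulmx (invmx (B + diag_mx d)))); rewrite K mulmx0 => w0.
by have := w_neq0 i; rewrite w0 mxE eqxx.
Qed.
End NMatrix.

(** * From contiguous minors to all minors *)

Section Fekete.
Variable R : realFieldType.

Definition minor_kernel n (M : 'M[R]_(n, n.+1)) : 'cV[R]_n.+1 :=
  \col_j ((-1) ^+ j * \det (col' j M)).

(** Each entry of the product is the expansion along its first row of the
    determinant of [M] with one of its own rows repeated on top. *)
Lemma mul_minor_kernel n (M : 'M[R]_(n, n.+1)) : M *m minor_kernel M = 0.
Proof.
apply/colP=> i; rewrite mxE [RHS]mxE.
(* The default [i] puts a copy of row [i] of [M] above [M]. *)
pose Q : 'M_n.+1 := \matrix_(a, j) M (odflt i (unlift ord0 a)) j.
have : \det Q = 0.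
  apply: (determinant_alternate (neq_lift ord0 i)) => j.
  by rewrite !mxE unlift_none liftK.
rewrite (expand_det_row _ ord0) => E; rewrite -[RHS]E.
apply: eq_bigr => j _; rewrite !mxE unlift_none; congr (_ * (_ * \det _)).
by apply/matrixP=> a b; rewrite !mxE liftK.
Qed.

Lemma mulmx_col'_row' m n (K : 'M[R]_(m, n.+1)) (z : 'cV_n.+1) p :
  z p 0 = 0 -> K *m z = col' p K *m row' p z.
Proof.
move=> zp; apply/colP=> i; rewrite !mxE (bigD1_ord p)//= zp mulr0 add0r.
by apply: eq_bigr => j _; rewrite !mxE.
Qed.

Definition extend0 n (p : 'I_n.+1) (u : 'cV[R]_n) : 'cV[R]_n.+1 :=
  \col_j if unlift p j is Some j' then u j' 0 else 0.

Lemma extend0_id n (p : 'I_n.+1) u : extend0 p u p 0 = 0.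
Proof. by rewrite mxE unlift_none. Qed.

Lemma extend0_lift n (p : 'I_n.+1) u j : extend0 p u (lift p j) 0 = u j 0.
Proof. by rewrite mxE liftK. Qed.

Lemma mul_extend0 m n (K : 'M[R]_(m, n.+1)) p u :
  K *m extend0 p u = col' p K *m u.
Proof.
rewrite (mulmx_col'_row' _ (extend0_id p u)); congr (_ *m _).
by apply/colP=> j; rewrite mxE extend0_lift.
Qed.

(** Let [K] be [M] without its first row.  Deleting the last or the first column
    of [K] gives matrices whose kernel vectors of minors, padded with a zero, are
    vectors [U] and [W] (up to sign) of the plane [ker K], both with strictly
    alternating coordinates of the same phase on their supports.  The vector [v]
    of the minors of [M] is in this plane, and its extreme coordinates say that
    it is a positive combination of [U] and [W], so that its interior coordinates
    have the same alternating signs. This is a form of the three-term Plücker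
    relation that requires no reordering of columns. *)
Lemma neg_minors_interpolate s (M : 'M[R]_(s.+2, s.+3)) :
  (forall g : {ffun 'I_s.+1 -> 'I_s.+3}, increasing_sel g ->
     \det (mxsub (lift ord0) g M) < 0) ->
  \det (col' ord0 M) < 0 -> \det (col' ord_max M) < 0 ->
  forall p, \det (col' p M) < 0.
Proof.
move=> hK d0 dm p.
pose K := row' ord0 M.
have hK2 a b : \det (col' b (col' a K)) < 0.
  have := hK _ (increasing_comp_lift b (@increasing_lift _ a)).
  by congr (\det _ < 0); apply/matrixP=> i j; rewrite !mxE !ffunE.
pose v := minor_kernel M.
have Kv : K *m v = 0.
  by rewrite /K row'Esub mul_rowsub_mx mul_minor_kernel; apply/matrixP=> i j; rewrite !mxE.
pose U := extend0 ord_max (minor_kernel (col' ord_max K)).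
pose W := - extend0 ord0 (minor_kernel (col' ord0 K)).
have KU : K *m U = 0 by rewrite mul_extend0 mul_minor_kernel.
have KW : K *m W = 0 by rewrite mulmxN mul_extend0 mul_minor_kernel oppr0.
have Um : U ord_max 0 = 0 by exact: extend0_id.
have W0 : W ord0 0 = 0 by rewrite mxE extend0_id oppr0.
have US j : j != ord_max -> exists2 c, c < 0 & U j 0 = (-1) ^+ j * c.
  case: (unliftP ord_max j) => [j' -> _|->]; last by rewrite eqxx.
  exists (\det (col' j' (col' ord_max K))) => //.
  by rewrite extend0_lift mxE lift_max.
have WS j : j != ord0 -> exists2 c, c < 0 & W j 0 = (-1) ^+ j * c.
  case: (unliftP ord0 j) => [j' -> _|->]; last by rewrite eqxx.
  exists (\det (col' j' (col' ord0 K))) => //.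
  by rewrite mxE extend0_lift mxE lift0 exprS mulN1r mulNr.
have [u0 u0_lt0 U0E] := US ord0 isT.
have [wm wm_lt0 WmE] := WS ord_max isT.
pose a := \det (col' ord0 M) / u0; pose b := \det (col' ord_max M) / wm.
have a_gt0 : 0 < a by rewrite nmulr_lgt0// invr_lt0.
have b_gt0 : 0 < b by rewrite nmulr_lgt0// invr_lt0.
pose z := v - a *: U - b *: W.
have Kz : K *m z = 0.
  by rewrite /z !mulmxBr -!scalemxAr Kv KU KW !scaler0 !subr0.
have z0 : z ord0 0 = 0.
  have -> : z ord0 0 = v ord0 0 - a * U ord0 0 - b * W ord0 0 by rewrite !mxE.
  by rewrite W0 U0E /a mxE mulr0 subr0 !expr0 !mul1r divfK ?subrr ?lt_eqF.
have zm : z ord_max 0 = 0.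
  have -> : z ord_max 0 = v ord_max 0 - a * U ord_max 0 - b * W ord_max 0.
    by rewrite !mxE.
  rewrite Um WmE /b mxE mulr0 subr0 mulrCA divfK ?subrr// lt_eqF//.
(* With its two extreme coordinates zero, [z] is killed by an invertible square
   submatrix of [K]. *)
have z_eq0 : z = 0.
  have z'm : row' ord0 z ord_max 0 = 0 by rewrite mxE -[RHS]zm; congr (z _ _); exact/val_inj.
  move: Kz; rewrite (mulmx_col'_row' _ z0) (mulmx_col'_row' _ z'm).
  have /ltr0_neq0 := hK2 ord0 ord_max; rewrite -unitfE => /mulKmx Kinv.
  move/(congr1 (mulmx (invmx (col' ord_max (col' ord0 K))))).
  rewrite Kinv mulmx0 => z''.
  apply/colP=> j; rewrite [RHS]mxE.
  case: (unliftP ord0 j) => [j' ->|->//].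
  case: (unliftP ord_max j') => [j'' ->|->].
    by move/colP: z'' => /(_ j''); rewrite !mxE.
  by move: z'm; rewrite mxE.
have [->//|p0] := eqVneq p ord0; have [->//|pm] := eqVneq p ord_max.
have [c c_lt0 UpE] := US p pm; have [e e_lt0 WpE] := WS p p0.
have : v p 0 = a * U p 0 + b * W p 0.
  have /colP/(_ p) := z_eq0; rewrite !mxE => ?; lra.
rewrite UpE WpE mxE => E.
have /(mulfI (negbT (signr_eq0 R p))) -> : (-1) ^+ p * \det (col' p M) =
  (-1) ^+ p * (a * c + b * e) by rewrite E; ring.
nra.
Qed.


Lemma increasing_gap r n (g : {ffun 'I_r.+1 -> 'I_n}) :
  increasing_sel g -> ~ contiguous_sel g ->
  exists i j : 'I_r.+1, j = i.+1 :> nat /\ ((g i).+1 < g j)%N.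
Proof.
move=> hg ncg.
case: (pickP (fun ij : 'I_r.+1 * 'I_r.+1 =>
  (ij.2 == ij.1.+1 :> nat) && ((g ij.1).+1 < g ij.2)%N)) => [[i j]|nogap].
  by move=> /= /andP[/eqP ij gap]; exists i, j.
case: ncg; exists (g ord0) => -[i ir].
elim: i ir => [|i IHi] ir; first by rewrite addn0; congr (nat_of_ord (g _)); exact/val_inj.
have := nogap (Ordinal (ltnW ir), Ordinal ir); rewrite /= eqxx/= => /negbT.
rewrite -leqNgt => le1.
have lt1 : (g (Ordinal (ltnW ir)) < g (Ordinal ir))%N by exact: hg.
by rewrite addnS -(IHi (ltnW ir)); apply/eqP; rewrite eqn_leq le1.
Qed.

(** A non-contiguous selection skips some index; inserting the successor of
    the left end of a gap exhibits [g] as a longer selection with an interior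
    element omitted. *)
Lemma increasing_insert r n (g : {ffun 'I_r.+1 -> 'I_n}) :
  increasing_sel g -> ~ contiguous_sel g ->
  exists (h : {ffun 'I_r.+2 -> 'I_n}) (p : 'I_r.+2),
    [/\ increasing_sel h, g = [ffun i => h (lift p i)],
      p != ord0 & p != ord_max].
Proof.
move=> hg /(increasing_gap hg)[i [j [ij gap]]].
have cn : ((g i).+1 < n)%N by exact: ltn_trans (ltn_ord (g j)).
pose p : 'I_r.+2 := lift ord0 i; pose c := Ordinal cn.
have hi : (i < r)%N by have := ltn_ord j; rewrite ij ltnS.
exists [ffun k => if unlift p k is Some k' then g k' else c], p; split.
- move=> a b; rewrite !ffunE.
  case: (unliftP p a) => [a' ->|->]; case: (unliftP p b) => [b' ->|->].
  + by rewrite ltn_lift; exact: hg.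
  + rewrite /= /bump leq0n add1n => ab; rewrite ltnS.
    apply: increasing_ge => //.
    by rewrite leqNgt; apply/negP => ia; move: ab; rewrite ia; lia.
  + rewrite /= /bump leq0n add1n => ab.
    apply: leq_trans gap _; apply: increasing_ge => //; rewrite ij.
    by rewrite ltnNge; apply/negP => bi; move: ab; rewrite (ltnNge i) bi; lia.
  + by rewrite ltnn.
- by apply/ffunP=> k; rewrite !ffunE liftK.
- by apply/eqP=> /(congr1 val).
- apply/eqP=> /(congr1 val)/=; rewrite /bump leq0n add1n => -[e].
  by rewrite e ltnn in hi.
Qed.

(** Induction on the spread [g ord_max - g ord0]: inserting a missing index [c]
    between the extreme ones, the two selections obtained by omitting the first or
    the last index instead of [c] have a smaller spread. *)
Lemma fekete_columns m n s (A : 'M[R]_(m, n)) (f : {ffun 'I_s.+2 -> 'I_m}) :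
  (forall (f' : {ffun 'I_s.+1 -> 'I_m}) (g : {ffun 'I_s.+1 -> 'I_n}),
     increasing_sel f' -> increasing_sel g -> \det (mxsub f' g A) < 0) ->
  increasing_sel f ->
  (forall g : {ffun 'I_s.+2 -> 'I_n}, contiguous_sel g -> \det (mxsub f g A) < 0) ->
  forall g : {ffun 'I_s.+2 -> 'I_n}, increasing_sel g -> \det (mxsub f g A) < 0.
Proof.
move=> minors hf contig g.
move: {2}(_ - _)%N (leqnn (g ord_max - g ord0)) => N.
elim: N => [|N IHN] in g * => hN hg.
  suff: (g ord0 < g ord_max)%N by rewrite -subn_gt0 ltnNge hN.
  exact: hg.
have [cg|ncg] := pselect (contiguous_sel g); first exact: contig.
have [h [p [hh gE p0 pm]]] := increasing_insert hg ncg.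
have detE q : \det (mxsub f [ffun i => h (lift q i)] A)
    = \det (col' q (mxsub f h A)).
  by congr (\det _); apply/matrixP=> i j; rewrite !mxE !ffunE.
have [q0 ep] : exists q, ord0 = lift p q.
  by case: (unliftP p ord0) p0 => [q -> _|->]; [exists q|rewrite eqxx].
have g0 : g ord0 = h ord0.
  rewrite gE ffunE; congr (h _); apply/val_inj; rewrite /= /bump.
  by case: p p0 {gE pm ep} => -[].
have gm : g ord_max = h ord_max.
  rewrite gE ffunE; congr (h _); apply/val_inj; rewrite /= /bump.
  have : (p < s.+2)%N by rewrite ltn_neqAle pm -ltnS ltn_ord.
  by rewrite ltnS => ->.
have h0 : (h ord0 < h (lift ord0 ord0))%N by exact: hh.
have hm : (h (lift ord_max ord_max) < h ord_max)%N.
  by apply: hh; rewrite lift_max.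
have hmid : (h (lift ord0 ord0) <= h (lift ord_max ord_max))%N.
  by apply: increasing_ge => //; rewrite lift_max.
rewrite g0 gm in hN.
have lift0_max : lift ord0 (@ord_max s.+1) = ord_max by exact/val_inj.
have liftm_0 : lift (@ord_max s.+2) ord0 = ord0 by exact/val_inj.
rewrite gE detE; apply: neg_minors_interpolate.
- move=> k hk.
  have := minors [ffun i => f (lift ord0 i)] [ffun i => h (k i)].
  rewrite (_ : mxsub _ _ A = mxsub (lift ord0) k (mxsub f h A)); last first.
    by apply/matrixP=> i j; rewrite !mxE !ffunE.
  apply; first exact: increasing_comp_lift.
  by move=> i j ij; rewrite !ffunE; exact/hh/hk.
- rewrite -detE; apply: IHN; last exact: increasing_comp_lift.
  rewrite !ffunE lift0_max; lia.
- rewrite -detE; apply: IHN; last exact: increasing_comp_lift.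
  rewrite !ffunE liftm_0; lia.
Qed.

Lemma fekete m n s (A : 'M[R]_(m, n)) :
  (forall (f : {ffun 'I_s.+1 -> 'I_m}) (g : {ffun 'I_s.+1 -> 'I_n}),
     increasing_sel f -> increasing_sel g -> \det (mxsub f g A) < 0) ->
  (forall (f : {ffun 'I_s.+2 -> 'I_m}) (g : {ffun 'I_s.+2 -> 'I_n}),
     contiguous_sel f -> contiguous_sel g -> \det (mxsub f g A) < 0) ->
  forall (f : {ffun 'I_s.+2 -> 'I_m}) (g : {ffun 'I_s.+2 -> 'I_n}),
     increasing_sel f -> increasing_sel g -> \det (mxsub f g A) < 0.
Proof.
have trE r (f : {ffun 'I_r -> 'I_m}) (g : {ffun 'I_r -> 'I_n}) :
  \det (mxsub f g A) = \det (mxsub g f A^T) by rewrite -det_tr trmx_mxsub.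
move=> minors contig f g hf hg.
apply: fekete_columns hg => // {}g cg; rewrite trE.
apply: fekete_columns hf => //.
- by move=> *; rewrite -trE; exact: minors.
- exact: contiguous_increasing.
- by move=> *; rewrite -trE; exact: contig.
Qed.

End Fekete.

(** * The sign test on columns of the adjugate *)

Section AdjugateTest.
Variable R : realType.

(** The checkerboard signs of the cofactors and the alternating signs of [alpha]
    combine into sums of products [minor * a_j] of constant sign, which do not
    vanish because some [a_j] is nonzero. *)
Lemma adj_admissible s (B : 'M[R]_s.+1) (alpha : 'cV[R]_s.+1) :
  (forall i j, \det (row' i (col' j B)) < 0) -> admissible alpha ->
  exists2 S : 'I_s.+1 -> R,
    forall i : 'I_s.+1, (\adj B *m alpha) i 0 = (-1) ^+ i * S i &
    ((forall i, S i < 0) /\ (forall i : 'I_s.+1, 0 <= (-1) ^+ i * alpha i 0)) \/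
    ((forall i, 0 < S i) /\ (forall i : 'I_s.+1, (-1) ^+ i * alpha i 0 <= 0)).
Proof.
move=> minors [alpha0 [a [ha alphaE]]].
have aE (i : 'I_s.+1) : (-1) ^+ i * alpha i 0 = a i 0.
  by rewrite alphaE mxE mulrA -expr2 sqrr_sign mul1r.
have [j0 aj0] : exists j, a j 0 != 0.
  apply/existsP; apply: contra_neqT alpha0 => /existsPn a0.
  by apply/colP=> j; rewrite alphaE !mxE (eqP (negbNE (a0 j))) mulr0.
exists (fun i => \sum_j \det (row' j (col' i B)) * a j 0).
  move=> i; rewrite mxE mulr_sumr; apply: eq_bigr => j _.
  rewrite mxE /cofactor alphaE mxE exprD.
  by rewrite mulrACA [_ * _ ^+ j]mulrAC -expr2 sqrr_sign mul1r.
case: ha => ha; [left|right]; split=> i; rewrite ?aE//.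
- rewrite (bigD1 j0)//= -[ltRHS]addr0 ltr_leD//.
    by rewrite nmulr_rlt0// lt_neqAle eq_sym aj0 ha.
  by apply: sumr_le0 => j _; rewrite mulr_le0_ge0// ltW.
- rewrite (bigD1 j0)//= ltr_pwDl//.
    by rewrite nmulr_rgt0// lt_neqAle aj0 ha.
  by apply: sumr_ge0 => j _; rewrite mulr_le0// ltW.
Qed.

Lemma adj_admissible_alternating s (B : 'M[R]_s.+1) (alpha : 'cV[R]_s.+1) :
  (forall i j, \det (row' i (col' j B)) < 0) -> admissible alpha ->
  alternating (\adj B *m alpha).
Proof.
move=> minors /(adj_admissible minors)[S xE hS].
have S0 i : S i != 0.
  by case: hS => -[h _]; [exact: ltr0_neq0|exact: lt0r_neq0].
have SS i j : 0 < S i * S j.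
  by case: hS => -[h _]; [rewrite nmulr_rgt0|rewrite pmulr_rgt0].
split=> [i|i j ij]; first by rewrite xE mulf_neq0// signr_eq0.
rewrite !xE ij exprS.
by rewrite mulN1r mulNr mulrN oppr_lt0 mulrACA -expr2 sqrr_sign mul1r.
Qed.

(** Since [B *m (\adj B *m alpha)] is [\det B *: alpha], and [\adj B *m alpha] and
    [alpha] nowhere have the same sign, the index that passes the test
    reveals the sign of [\det B]. *)
Lemma det_neg_of_test s (B : 'M[R]_s.+1) (alpha : 'cV[R]_s.+1) :
  (forall i j, \det (row' i (col' j B)) < 0) -> admissible alpha ->
  (exists i, 0 < (\adj B *m alpha) i 0 * (B *m (\adj B *m alpha)) i 0) ->
  \det B < 0.
Proof.
move=> minors /(adj_admissible minors)[S xE hS] [i].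
rewrite mulmxA mul_mx_adj mul_scalar_mx [X in _ * X]mxE xE.
have Sa : S i * ((-1) ^+ i * alpha i 0) <= 0.
  by case: hS => -[S0 a0]; [rewrite nmulr_rle0|rewrite pmulr_rle0].
rewrite (mulrC _ (S i)) [\det B * _]mulrC mulrA -[S i * _ * _]mulrA.
by apply: contraTT; rewrite -!leNgt => /(mulr_le0_ge0 Sa).
Qed.

Lemma minor_neg_of_all m n s (A : 'M[R]_(m, n))
    (f : {ffun 'I_s.+2 -> 'I_m}) (g : {ffun 'I_s.+2 -> 'I_n}) i j :
  (forall (f : {ffun 'I_s.+1 -> 'I_m}) (g : {ffun 'I_s.+1 -> 'I_n}),
     increasing_sel f -> increasing_sel g -> \det (mxsub f g A) < 0) ->
  increasing_sel f -> increasing_sel g ->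
  \det (row' i (col' j (mxsub f g A))) < 0.
Proof.
move=> minors hf hg.
have := minors _ _ (increasing_comp_lift i hf) (increasing_comp_lift j hg).
by congr (\det _ < 0); apply/matrixP=> a b; rewrite !mxE !ffunE.
Qed.

(** The test is only required for submatrices whose minors of the previous order
    are negative: in the induction this makes the tested vectors alternating, so
    that sign non-reversal on alternating vectors is a sufficient hypothesis. *)
Lemma totally_negative_of_test m n k (A : 'M[R]_(m, n)) :
  (forall i j, A i j < 0) ->
  (forall s (f : {ffun 'I_s.+2 -> 'I_m}) (g : {ffun 'I_s.+2 -> 'I_n}),
     (s.+2 <= k)%N -> contiguous_sel f -> contiguous_sel g ->
     (forall i j, \det (row' i (col' j (mxsub f g A))) < 0) ->
     exists2 alpha, admissible alpha &
       exists i, 0 < (\adj (mxsub f g A) *m alpha) i 0 *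
         (mxsub f g A *m (\adj (mxsub f g A) *m alpha)) i 0) ->
  totally_negative k A.
Proof.
move=> A0 test; elim=> [//|[_|s IHs]] f g /andP[_ sk].
  by rewrite det_mx11 mxE.
apply: fekete => [f' g' hf' hg'|{}f {}g cf cg]; first exact: IHs (ltnW sk) _ _.
have minors i j : \det (row' i (col' j (mxsub f g A))) < 0.
  apply: minor_neg_of_all; [|exact: contiguous_increasing..] => f' g'.
  exact: IHs (ltnW sk).
have [alpha adm ex] := test s f g sk cf cg minors.
exact: det_neg_of_test ex.
Qed.

End AdjugateTest.

Theorem theorem2 (R : realType) (m n k : nat)
  (hk : (2 <= k)%N) (hm : (k <= m)%N) (hn : (k <= n)%N)
  (A : 'M[R]_(m, n)) (hA : forall i j, A i j < 0)
  (alpha : forall r : nat,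
     {ffun 'I_r -> 'I_m} -> {ffun 'I_r -> 'I_n} -> 'cV[R]_r)
  (halpha : forall (r : nat)
     (f : {ffun 'I_r -> 'I_m}) (g : {ffun 'I_r -> 'I_n}),
     (2 <= r <= k)%N -> contiguous_sel f -> contiguous_sel g ->
     admissible (alpha r f g)) :
  [<-> totally_negative k A;
       forall (r : nat) (f : {ffun 'I_r -> 'I_m}) (g : {ffun 'I_r -> 'I_n}),
         (2 <= r <= k)%N -> increasing_sel f -> increasing_sel g ->
         sign_non_reversal (mxsub f g A) (@mixed_sign R r);
       forall (r : nat) (f : {ffun 'I_r -> 'I_m}) (g : {ffun 'I_r -> 'I_n}),
         (2 <= r <= k)%N -> contiguous_sel f -> contiguous_sel g ->
         sign_non_reversal (mxsub f g A) (@alternating R r);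
       forall (r : nat) (f : {ffun 'I_r -> 'I_m}) (g : {ffun 'I_r -> 'I_n}),
         (2 <= r <= k)%N -> contiguous_sel f -> contiguous_sel g ->
         sign_non_reversal (mxsub f g A)
           [set (\adj (mxsub f g A) *m alpha r f g)]].
Proof.
have alt_neq0 s (x : 'cV[R]_s.+1) : alternating x -> x != 0.
  by case=> /(_ ord0) + _; apply: contraNneq => ->; rewrite mxE.
have minors s (f : {ffun 'I_s.+2 -> 'I_m}) (g : {ffun 'I_s.+2 -> 'I_n}) i j :
    totally_negative k A -> (s.+2 <= k)%N ->
    contiguous_sel f -> contiguous_sel g ->
    \det (row' i (col' j (mxsub f g A))) < 0.
  move=> TN sk cf cg; apply: minor_neg_of_all; [|exact: contiguous_increasing..].
  by move=> f' g'; exact: (TN s.+1 _ _ (ltnW sk)).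
tfae.
- move=> TN r f g /andP[r2 rk] hf hg x [xp xm] _.
  apply: N_matrix_mixed_sign => // [i j|s h s0 hh]; first by rewrite mxE.
  rewrite (_ : mxsub _ _ _ = mxsub [ffun i => f (h i)] [ffun i => g (h i)] A).
    have sr : (s <= r)%N.
      have h_inj : injective h.
        move=> i j hij; apply/val_inj; case: (ltngtP i j) => // /hh.
          by rewrite hij ltnn.
        by rewrite hij ltnn.
      by have := leq_card _ h_inj; rewrite !card_ord.
    apply: TN; first by rewrite s0 (leq_trans sr).
      by move=> i j ij; rewrite !ffunE; exact/hf/hh.
    by move=> i j ij; rewrite !ffunE; exact/hg/hh.
  by apply/matrixP=> i j; rewrite !mxE !ffunE.
- move=> mixed [//|[//|s]] f g sk cf cg x [x0 alt] xn0.
  apply: mixed xn0 => //; [exact: contiguous_increasing..|].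
  have := alt ord0 (lift ord0 ord0) erefl.
  have := x0 ord0; case: (ltgtP (x ord0 0) 0) => // xs _.
    rewrite nmulr_rlt0// => xs'; split; last by exists ord0.
    by exists (lift ord0 ord0).
  rewrite pmulr_rlt0// => xs'; split; first by exists ord0.
  by exists (lift ord0 ord0).
(* The vectors of the last condition are known to be alternating only once total
   negativity has been established. *)
- move=> alt.
  have TN : totally_negative k A.
    apply: totally_negative_of_test => // s f g sk cf cg hminors.
    have adm := halpha s.+2 f g sk cf cg; exists (alpha s.+2 f g) => //.
    have x_alt := adj_admissible_alternating hminors adm.
    exact: alt (alt_neq0 _ _ x_alt).
  move=> [//|[//|s]] f g sk cf cg x -> x0.
  apply: alt => //; apply: adj_admissible_alternating; last exact: halpha.
  by move=> i j; exact: minors.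
- move=> single; apply: totally_negative_of_test => // s f g sk cf cg hminors.
  have adm := halpha s.+2 f g sk cf cg; exists (alpha s.+2 f g) => //.
  apply: single => //.
  exact/alt_neq0/adj_admissible_alternating.
Qed.
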